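(* Let $\langle\phi,\vec{a}\rangle$ be a loop with $\phi(\vec{x})\equiv\bigwedge_{i=1}^k C_i$, where each clause $C_i$ contains a literal $\mathit{expr}_i(\vec{x})>0$ such that for all $\vec{x}\in\mathbb{Z}^d$: $\mathit{expr}_i(\vec{x})\ge\mathit{expr}_i(\vec{a}(\vec{x}))\implies\mathit{expr}_i(\vec{a}(\vec{x}))\ge\mathit{expr}_i(\vec{a}^2(\vec{x}))$. Then the formula $\psi:=\vec{x}'=\vec{a}^n(\vec{x})\land\bigwedge_{i=1}^k\big(\mathit{expr}_i(\vec{x})>0\land\mathit{expr}_i(\vec{a}^{n-1}(\vec{x}))>0\big)$ approximates $\langle\phi,\vec{a}\rangle$ (so the acceleration technique mapping such loops to $\psi$ is sound). If moreover $C_i\equiv\mathit{expr}_i>0$ for all $i\in[1,k]$, then $\psi$ is equivalent to $\langle\phi,\vec{a}\rangle$ (the technique is exact).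
   Context: $\vec{x}=(x_1,\dots,x_d)$ ranges over $\mathbb{Z}^d$, $n$ is a variable, $\vec{x}'=(x_1',\dots,x_d')$. Formulas are finite quantifier-free propositional formulas in CNF with atoms $p>0$, $p$ a closed-form arithmetic expression (built from variables, integer constants, $+,-,\cdot,/$, exponentiation). A loop $\langle\phi,\vec{a}\rangle$ consists of a formula $\phi$ over $\vec{x}$ and $\vec{a}:\mathbb{Z}^d\to\mathbb{Z}^d$ given by closed-form expressions; it induces $\vec{x}\longrightarrow_{\langle\phi,\vec{a}\rangle}\vec{x}'$ iff $\phi(\vec{x})\land\vec{x}'=\vec{a}(\vec{x})$, with $\longrightarrow^n$ its $n$-fold composition; $\vec{a}^n$ is the $n$-fold application of $\vec{a}$. A formula $\psi$ over $(\vec{x},n,\vec{x}')$ approximates the loop if for all $n>0$ and $\vec{x},\vec{x}'\in\mathbb{Z}^d$, $\psi\implies\vec{x}\longrightarrow^n_{\langle\phi,\vec{a}\rangle}\vec{x}'$, and is equivalent to it if $\psi\iff\vec{x}\longrightarrow^n_{\langle\phi,\vec{a}\rangle}\vec{x}'$ for all $n>0$. *)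

(* Defs.v *)
From HB Require Import structures.
From mathcomp Require Import all_boot all_order all_algebra.
From mathcomp Require Import boolp reals exp.

Set Implicit Arguments.
Unset Strict Implicit.
Unset Printing Implicit Defensive.

Import Order.TTheory GRing.Theory Num.Theory.
Local Open Scope ring_scope.

Inductive expr (d : nat) : Type :=
| Var of 'I_d
| Cst of int
| Add of expr d & expr d
| Sub of expr d & expr d
| Mul of expr d & expr d
| Div of expr d & expr d
| Pow of expr d & expr d.

Arguments Cst {d}.

(* Integer exponents (possibly negative) allow any base, so that for instance
   (-2) ^ 3 = -8; the real power [`^] is used for non-integer exponents.  It is
   the usual one for a positive base and 1 (a junk value) for a negative base. *)
Definition rpow (R : realType) (a b : R) : R :=
  if b \is a Num.int then a ^ Num.floor b else a `^ b.

(* Expressions take real values, since quotients and powers of integers need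
   not be integers.  Evaluation is total: it inherits z / 0 = 0 from MathComp. *)
Fixpoint eval (R : realType) (d : nat) (e : expr d) (x : 'rV[int]_d) : R :=
  match e with
  | Var i => (x 0 i)%:~R
  | Cst c => c%:~R
  | Add e1 e2 => eval R e1 x + eval R e2 x
  | Sub e1 e2 => eval R e1 x - eval R e2 x
  | Mul e1 e2 => eval R e1 x * eval R e2 x
  | Div e1 e2 => eval R e1 x / eval R e2 x
  | Pow e1 e2 => rpow (eval R e1 x) (eval R e2 x)
  end.

(* [Pos p] is the atom p > 0 and [Neg p] its negation. *)
Inductive literal (d : nat) : Type := Pos of expr d | Neg of expr d.

HB.instance Definition _ (d : nat) := gen_eqMixin (literal d).

Definition clause (d : nat) := seq (literal d).

(* Conjunctive normal form. *)
Definition formula (d : nat) := seq (clause d).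

Definition holds_literal (R : realType) (d : nat) (l : literal d)
    (x : 'rV[int]_d) : bool :=
  match l with
  | Pos p => 0 < eval R p x
  | Neg p => ~~ (0 < eval R p x)
  end.

Definition holds (R : realType) (d : nat) (phi : formula d)
    (x : 'rV[int]_d) : bool :=
  all (has (fun l => holds_literal R l x)) phi.

Definition equiv_formula (R : realType) (d : nat) (phi psi : formula d) : Prop :=
  forall x : 'rV[int]_d, holds R phi x = holds R psi x.

Definition closed_form (R : realType) (d : nat)
    (a : 'rV[int]_d -> 'rV[int]_d) : Prop :=
  exists e : 'I_d -> expr d, forall x i, eval R (e i) x = (a x 0 i)%:~R.

Record loop (R : realType) (d : nat) := Loop {
  guard : formula d;
  update : 'rV[int]_d -> 'rV[int]_d;
  update_closed_form : closed_form R update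
}.

Definition step (R : realType) (d : nat) (L : loop R d)
    (x x' : 'rV[int]_d) : Prop :=
  holds R (guard L) x /\ x' = update L x.

Fixpoint rel_iter (T : Type) (n : nat) (r : T -> T -> Prop) (x y : T) : Prop :=
  if n is n'.+1 then exists2 z, r x z & rel_iter n' r z y else x = y.

(* The iterate a^n for symbolic n is in general not an [expr], so formulas over
   (x, n, x') are represented by the relations that they define. *)
Definition iformula (d : nat) : Type := 'rV[int]_d -> nat -> 'rV[int]_d -> Prop.

Definition approximates (R : realType) (d : nat) (psi : iformula d)
    (L : loop R d) : Prop :=
  forall n, (0 < n)%N -> forall x x', psi x n x' -> rel_iter n (step L) x x'.

Definition equivalent (R : realType) (d : nat) (psi : iformula d)
    (L : loop R d) : Prop :=
  forall n, (0 < n)%N -> forall x x', psi x n x' <-> rel_iter n (step L) x x'.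

Definition accelerated (R : realType) (d : nat) (L : loop R d) (k : nat)
    (e : 'I_k -> expr d) : iformula d := fun x n x' =>
  x' = iter n (update L) x /\
  forall i, 0 < eval R (e i) x /\ 0 < eval R (e i) (iter n.-1 (update L) x).

(* Main.v *)
(* The hypothesis says that once a step fails to increase expr_i along an orbit,
   no later step increases it.  So the values of expr_i first increase strictly
   and then weakly decrease, and each of them is at least the smaller of the
   first and the last: positivity at both ends of the orbit gives positivity
   throughout. *)
Require Import Defs.
From mathcomp Require Import all_boot all_order all_algebra.
From mathcomp Require Import boolp reals exp.

Set Implicit Arguments.
Unset Strict Implicit.
Unset Printing Implicit Defensive.

Import Order.TTheory GRing.Theory Num.Theory.
Local Open Scope ring_scope.

Lemma min_ends_le (disp : Order.disp_t) (T : orderType disp) (u : nat -> T)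
    (m n : nat) :
  (forall i, u i.+1 <= u i -> u i.+2 <= u i.+1)%O -> (m <= n)%N ->
  (Order.min (u 0%N) (u n) <= u m)%O.
Proof.
elim: m n u => [|m IHm] [|n] u u_uni //; first by rewrite ge_min lexx.
  by rewrite ge_min lexx.
(* If [u] does not increase at first, it never does, and [u n.+1] is the lower bound. Otherwise
   [u 0 < u 1], and induction applies to the shifted sequence, whose first term is [u 1]. *)
move=> le_mn; have [le10|lt01] := leP (u 1%N) (u 0%N).
  have u_dec i : (u i.+1 <= u i)%O by elim: i.
  rewrite ge_min; apply/orP; right.
  apply: (@homo_leq _ u (fun x y => y <= x)%O) => // y x z le_yx le_zy.
  exact: le_trans le_yx.
have IH := IHm n (u \o succn) (fun i => u_uni i.+1) le_mn.
by apply: le_trans IH; rewrite le_min !ge_min (ltW lt01) lexx orbT.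
Qed.

(** Since [step] is deterministic, a run is determined by its start. The guard is tested before each
    update, so at the iterates of index [0] to [n - 1] and not at the final state. *)
Lemma rel_iter_stepP (R : realType) (d : nat) (L : loop R d) (n : nat)
    (x y : 'rV[int]_d) :
  rel_iter n (step L) x y <->
  y = iter n (update L) x /\
  forall m, (m < n)%N -> holds R (guard L) (iter m (update L) x).
Proof.
elim: n x y => [|n IHn] x y /=; first by split=> [->|[]].
split=> [[_ [gx ->] /IHn[-> g]]|[-> g]].
  by rewrite -iterSr; split=> // -[|m] // lt_mn; rewrite iterSr; exact: g.
exists (update L x); first by split=> //; exact: (g 0%N).
by apply/IHn; rewrite -iterSr; split=> // m lt_mn; rewrite -iterSr; exact: g.
Qed.

Theorem theorem10 (R : realType) (d : nat) (L : loop R d)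
    (k : nat) (C : 'I_k -> clause d) (e : 'I_k -> expr d)
    (hphi : equiv_formula R (guard L) (codom C))
    (hmem : forall i : 'I_k, Pos (e i) \in C i)
    (hmono : forall (i : 'I_k) (x : 'rV[int]_d),
       eval R (e i) (update L x) <= eval R (e i) x ->
       eval R (e i) (update L (update L x)) <= eval R (e i) (update L x)) :
  approximates (accelerated L e) L /\
  ((forall i : 'I_k, equiv_formula R [:: C i] [:: [:: Pos (e i)]]) ->
   equivalent (accelerated L e) L).
Proof.
have guardE x : holds R (guard L) x =
    [forall i, has (fun l => holds_literal R l x) (C i)].
  rewrite hphi /holds; apply/allP/forallP => [h i|h _ /codomP[i ->]] //.
  exact/h/codom_f.
have sound : approximates (accelerated L e) L.
  move=> n n_gt0 x x' [-> pos]; apply/rel_iter_stepP; split=> // m lt_mn.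
  rewrite guardE; apply/forallP => i; apply/hasP; exists (Pos (e i)) => //=.
  have [pos0 posn] := pos i.
  pose u j := eval R (e i) (iter j (update L) x).
  (* The right end is [n.-1], the last index at which the guard is tested; [m < n] becomes
     [m <= n.-1]. *)
  apply: lt_le_trans (_ : Order.min (u 0%N) (u n.-1) <= _).
    by rewrite lt_min pos0.
  apply: (@min_ends_le _ _ u) => [j|]; first exact: hmono.
  by rewrite -ltnS prednK.
split=> // hC n n_gt0 x x'; split=> [|/rel_iter_stepP[-> g]]; first exact: sound.
(* When each clause amounts to its chosen literal, the guard along the run gives positivity at every
   index below [n], in particular at [0] and [n.-1] because [0 < n]. *)
have pos m i : (m < n)%N -> 0 < eval R (e i) (iter m (update L) x).
  move=> /g; rewrite guardE => /forallP/(_ i).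
  by have := hC i (iter m (update L) x); rewrite /holds /= !andbT orbF => ->.
split=> // i; split; first exact: (pos 0%N).
by apply: pos; rewrite prednK.
Qed.
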